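(* Let $H$ be a monoid. The following are equivalent: (1) $H$ is a $t$-Bézout $t$-SP-monoid (i.e. both a $t$-Bézout monoid and a $t$-SP-monoid). (2) $H$ is a $w$-Bézout $w$-SP-monoid (i.e. both a $w$-Bézout monoid and a $w$-SP-monoid). (3) The radical of every principal ideal of $H$ is principal. (4) Every principal ideal of $H$ is a product of finitely many pairwise comparable radical principal ideals.
   Context: A monoid $H$ is a commutative semigroup with identity and more than one element in which every nonzero element is cancellative. Here $z(H)=\{z\in H: zx=z \text{ for all } x\in H\}$ ($|z(H)|\le 1$, possibly empty); ''nonzero'' means not in $z(H)$; $H^{\bullet}=H\setminus z(H)$; $G=(H^{\bullet})^{-1}H$ is the quotient monoid; $\mathbb{N}$ is the set of positive integers. For $X\subseteq H$, $\sqrt X=\{x\in H: x^n\in X\text{ for some }n\in\mathbb{N}\}$; for $Y\subseteq G$, $Y^{-1}=\{z\in G: zY\subseteq H\}$. A subset $X\subseteq H$ is radical if $\sqrt X=X$. A principal ideal is a set $AH\cup z(H)$ with $A\subseteq H$, $|A|\le 1$. An ideal $X$ is nontrivial if $z(H)\subsetneq X$. The $t$-system on $H$: if $H=G$, then for $X\subseteq H$ put $X_t=z(H)$ if $X\subseteq z(H)$ and $X_t=H$ otherwise; if $H\neq G$, put $X_v=(X^{-1})^{-1}$ and $X_t=\bigcup_{E\subseteq X,|E|<\infty}E_v$. The $w$-system is $X_w=\{x\in H: xF\subseteq XH\cup z(H)\text{ and }F_t=H\text{ for some }F\subseteq H\}$. For $r\in\{t,w\}$: an $r$-ideal is an $X\subseteq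 H$ with $X_r=X$; an $r$-ideal $I$ is $r$-finitely generated if $I=E_r$ for some finite $E\subseteq I$. The $r$-product of $r$-ideals $I,J$ is $(IJ)_r$ (similarly for finitely many factors). $H$ is an $r$-SP-monoid if every $r$-ideal is a finite $r$-product of radical $r$-ideals. $H$ is an $r$-Bézout monoid if every nontrivial $r$-finitely generated $r$-ideal is principal. ''Comparable'' means comparable with respect to inclusion. *)

(* Defs.v *)
From HB Require Import structures.
From mathcomp Require Import all_boot.
From mathcomp Require Import boolp classical_sets functions cardinality.

Set Implicit Arguments.
Unset Strict Implicit.
Unset Printing Implicit Defensive.

Import Algebra.

Local Open Scope group_scope.
Local Open Scope classical_set_scope.
Local Open Scope quotient_scope.

(* z(H); it has at most one element, and is possibly empty *)
Definition zeros (H : magmaType) : set H := [set z | forall x, z * x = z].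
Arguments zeros : clear implicits.

HB.mixin Record Monoid_isNonzeroCancellative H of Monoid H := {
  mulmC : commutative (@mul H);
  monoid_nontrivial : exists x y : H, x <> y;
  mulmI : forall a : H, ~ zeros H a -> injective (mul a)
}.

#[short(type="nzCancMonoidType")]
HB.structure Definition NzCancMonoid :=
  {H of Monoid_isNonzeroCancellative H & Monoid H}.

Section QuotientMonoid.
Variable H : nzCancMonoidType.
Implicit Types x y : H.

Definition nonzero := {s : H | s \notin zeros H}.

Lemma zerosMl x y : zeros H x -> zeros H (x * y).
Proof. by move=> zx w; rewrite -mulgA !zx. Qed.

Lemma one_nonzero : (1 : H) \notin zeros H.
Proof.
apply/negP => /set_mem z1; have [x [y]] := monoid_nontrivial (s := H).
by apply; rewrite -(mul1g x) -(mul1g y) !z1.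
Qed.

Lemma mul_nonzero (s t : nonzero) : val s * val t \notin zeros H.
Proof.
apply/negP => /set_mem zst; have /negP := valP t; apply; apply/mem_set => w.
apply: (@mulmI H (val s)); first by move/mem_set; apply/negP/(valP s).
by rewrite mulgA zst.
Qed.

Definition nonzero1 : nonzero := Sub 1 one_nonzero.
Definition nonzeroM (s t : nonzero) : nonzero :=
  Sub (val s * val t) (mul_nonzero s t).

(* The pair (a, s) stands for the fraction s^-1 a. *)
Definition fraction_equiv (p q : H * nonzero) : bool :=
  p.1 * val q.2 == q.1 * val p.2.

Lemma mulm_nonzeroI (s : nonzero) x y : x * val s = y * val s -> x = y.
Proof.
rewrite !(mulmC _ (val s)); apply: mulmI.
by move/mem_set; apply/negP/(valP s).
Qed.

Lemma mulmACA : interchange (@mul H) (@mul H).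
Proof. by move=> a b c d; rewrite -!mulgA (mulgA b) (mulmC b) -mulgA. Qed.

Lemma fraction_equiv_refl : reflexive fraction_equiv.
Proof. by move=> p; rewrite /fraction_equiv. Qed.

Lemma fraction_equiv_sym : symmetric fraction_equiv.
Proof. by move=> p q; rewrite /fraction_equiv eq_sym. Qed.

Lemma fraction_equiv_trans : transitive fraction_equiv.
Proof.
move=> [b t] [a s] [c u] /eqP /= abE /eqP /= bcE; apply/eqP => /=.
apply: (@mulm_nonzeroI t).
rewrite -mulgA (mulmC (val u)) mulgA abE -mulgA (mulmC (val s)) mulgA bcE.
by rewrite -!mulgA (mulmC (val t)).
Qed.

Canonical fraction_equiv_rel := EquivRel fraction_equiv
  fraction_equiv_refl fraction_equiv_sym fraction_equiv_trans.

Definition quotient_monoid := {eq_quot fraction_equiv}.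
HB.instance Definition _ := Choice.on quotient_monoid.
HB.instance Definition _ := EqQuotient.on quotient_monoid.

Definition frac x (s : nonzero) : quotient_monoid := \pi_quotient_monoid (x, s).

Lemma fracE x y (s t : nonzero) :
  (frac x s = frac y t) <-> x * val t = y * val s.
Proof.
rewrite /frac; split=> [/eqmodP /eqP //|e].
by apply/eqmodP/eqP.
Qed.

Lemma fracP (z : quotient_monoid) : exists x (s : nonzero), z = frac x s.
Proof. by exists (repr z).1, (repr z).2; rewrite /frac -surjective_pairing reprK. Qed.

Definition qmul (z w : quotient_monoid) : quotient_monoid :=
  frac ((repr z).1 * (repr w).1) (nonzeroM (repr z).2 (repr w).2).

Lemma qmulE x y (s t : nonzero) :
  qmul (frac x s) (frac y t) = frac (x * y) (nonzeroM s t).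
Proof.
apply/fracE => /=; rewrite mulmACA [RHS]mulmACA.
suff reprE u (r : nonzero) :
    (repr (frac u r)).1 * val r = u * val (repr (frac u r)).2.
  by rewrite !reprE.
by apply/fracE; rewrite [LHS]/frac -surjective_pairing reprK.
Qed.

Definition qone : quotient_monoid := frac 1 nonzero1.

Lemma qmulA : associative qmul.
Proof.
move=> z1 z2 z3; have [x [s ->]] := fracP z1; have [y [t ->]] := fracP z2.
have [w [u ->]] := fracP z3; rewrite !qmulE; apply/fracE => /=.
by rewrite !mulgA.
Qed.

Lemma qmul1g : left_id qone qmul.
Proof.
move=> z; have [x [s ->]] := fracP z; rewrite qmulE; apply/fracE => /=.
by rewrite !mul1g.
Qed.

Lemma qmulg1 : right_id qone qmul.
Proof.
move=> z; have [x [s ->]] := fracP z; rewrite qmulE; apply/fracE => /=.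
by rewrite !mulg1.
Qed.

HB.instance Definition _ := isMonoid.Build quotient_monoid qmulA qmul1g qmulg1.

Lemma qmulC : commutative (@mul quotient_monoid).
Proof.
move=> z1 z2; have [x [s ->]] := fracP z1; have [y [t ->]] := fracP z2.
rewrite [LHS]qmulE [RHS]qmulE; apply/fracE => /=.
by rewrite (mulmC x) (mulmC (val s)).
Qed.

Definition emb x : quotient_monoid := frac x nonzero1.

Lemma emb_inj : injective emb.
Proof. by move=> x y /fracE /=; rewrite !mulg1. Qed.

Lemma emb1 : emb 1 = 1.
Proof. by []. Qed.

Lemma embM x y : emb (x * y) = emb x * emb y.
Proof. by rewrite [RHS]qmulE; apply/fracE => /=; rewrite !mulg1. Qed.

Lemma emb_nonzeroV (s : nonzero) : emb (val s) * frac 1 s = 1.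
Proof. by rewrite [LHS]qmulE; apply/fracE => /=; rewrite !mulg1 !mul1g. Qed.

Lemma fracEM x (s : nonzero) : frac x s = frac 1 s * emb x.
Proof. by rewrite [RHS]qmulE; apply/fracE => /=; rewrite mulg1 mul1g. Qed.

End QuotientMonoid.

Section Ideals.
Variable H : nzCancMonoidType.
Implicit Types (X Y I : set H).

Definition mulset X Y : set H := [set x * y | x in X & y in Y].

Definition radical X : set H := [set x | exists2 n, (0 < n)%N & X (x ^+ n)].

Definition is_radical X := radical X = X.

Definition principal_ideal X :=
  exists2 A : set H, is_subset1 A & X = mulset A setT `|` zeros H.

Definition nontrivial X := zeros H `<` X.

Definition comparable_sets X Y := X `<=` Y \/ Y `<=` X.

Definition quotient_inv (Y : set (quotient_monoid H)) :
    set (quotient_monoid H) :=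
  [set z | forall y, Y y -> range (@emb H) (z * y)].

(* The preimage loses nothing: 1 lies in (emb @` X)^-1, so that
   (X^-1)^-1 is contained in the image of H. *)
Definition v_closure X : set H :=
  @emb H @^-1` quotient_inv (quotient_inv (@emb H @` X)).

Definition t_closure X : set H :=
  if `[< range (@emb H) = setT >] then
    (if `[< X `<=` zeros H >] then zeros H else setT)
  else \bigcup_(E in [set E | E `<=` X /\ finite_set E]) v_closure E.

Definition w_closure X : set H :=
  [set x | exists2 F : set H,
     mulset [set x] F `<=` mulset X setT `|` zeros H & t_closure F = setT].

(* r stands for t_closure or w_closure *)
Variable r : set H -> set H.

Definition r_ideal X := r X = X.

Definition r_finitely_generated I :=
  r_ideal I /\ exists E, [/\ finite_set E, E `<=` I & I = r E].

Definition r_SP_monoid := forall X, r_ideal X ->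
  exists (n : nat) (I : 'I_n.+1 -> set H),
    (forall i, r_ideal (I i) /\ is_radical (I i)) /\
    X = r (\big[mulset/[set 1]]_(i < n.+1) I i).

Definition r_Bezout_monoid := forall I,
  nontrivial I -> r_finitely_generated I -> principal_ideal I.

End Ideals.

(* Main.v *)
Require Import Defs.
From mathcomp Require Import all_boot.
From mathcomp Require Import boolp classical_sets functions cardinality.

(** The four conditions are called (1) to (4) in their order, and everything is
    expressed through divisibility in H.

    Writing an element of X^-1 as a fraction a/s shows that x lies in X_v if
    and only if s | a x whenever s divides a y for all y in X.  If this x
    divides all of X, it is a greatest common divisor of X in a strong sense,
    stable under multiplication.  Hence the t-Bezout monoids are exactly the
    monoids with such gcds ([gcds_of_t_Bezout], [t_Bezout_of_gcds]), equivalently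
    with least common multiples, and in such a monoid the t-ideals are the
    ideals that are directed by divisibility ([t_ideal_directed],
    [directed_t_ideal]).

    (1) <-> (2): w is finer than t, and either Bezout property makes the two
    closures equal.  A finite set E generates a principal ideal dH; dividing
    E by d leaves a set with t-closure H, which puts d into E_w, and
    conversely dH is t-closed, so that E_w = dH contains E_t.

    (1) -> (3): if aH is the t-closure of a product of radical t-ideals I_i,
    directedness provides an element p of the product that is associated to
    a.  The factors of p generate the I_i, and the radical of aH, being the
    intersection of the I_i, is generated by their lcm ([factors_lcm]).

    (3) -> (4): the key remark is that if q e generates a radical ideal, then q
    and e are coprime: x in qH and in eH gives x^2 in q e H, hence x in q e H.
    Write a = r b with r a generator of the radical of aH, and let q generate
    the radical of bH, so that q | r.  The remark shows that a | r^(n+1) implies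
    b | q^n ([radical_cofactor_exp]), so that iterating stops, which is the
    induction principle [radical_ind].  The successive radicals increase, which
    makes the factors comparable.

    (4) -> (3): the radical of a product of a chain of radical ideals is the
    least of them ([radical_of_chain]).

    (3) -> (1): the lcm of two radical elements generates the radical of their
    product, and lcms pass from factors to products, so [radical_ind] yields
    all lcms and with them the t-Bezout property.  For a t-ideal J, the same
    remark shows that x | y implies x / rad x | y / rad y
    ([radical_cofactor_dvd]).  By this monotonicity, J is the product of
    its radical and of the t-ideal generated by all x / rad x with x in J
    ([radical_mul_cofactors]), and [radical_ind] applied to one nonzero
    element of J shows that finitely many such steps suffice. *)

Set Implicit Arguments.
Unset Strict Implicit.
Unset Printing Implicit Defensive.

Local Open Scope group_scope.
Local Open Scope classical_set_scope.

(** * Divisibility *)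

Definition divides (H : nzCancMonoidType) (a b : H) := exists c, b = a * c.

Local Notation "a %| b" := (divides a b) : group_scope.

Section Divisibility.
Variable H : nzCancMonoidType.
Implicit Types a b c d e x y z : H.

Lemma mulmCA a b c : a * (b * c) = b * (a * c).
Proof. by rewrite mulgA (mulmC a) -mulgA. Qed.

Lemma mulmAC a b c : a * b * c = a * c * b.
Proof. by rewrite -!mulgA (mulmC b). Qed.

Lemma expmMn a b n : (a * b) ^+ n = a ^+ n * b ^+ n.
Proof. exact/expgMn/mulmC. Qed.

Lemma zerosMr x y : zeros H y -> zeros H (x * y).
Proof. by rewrite mulmC; apply: zerosMl. Qed.

Lemma zeros_mul x y : zeros H (x * y) -> zeros H x \/ zeros H y.
Proof.
have [zx|nx] := pselect (zeros H x); first by left.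
by move=> zxy; right=> w; apply: (mulmI _ nx); rewrite mulgA zxy.
Qed.

Lemma zeros1F : ~ zeros H 1.
Proof. by move=> z1; have /negP := one_nonzero H; apply; apply/mem_set. Qed.

Lemma zeros_exp x n : zeros H (x ^+ n) -> zeros H x.
Proof.
by elim: n => [/zeros1F //|n IHn]; rewrite expgS => /zeros_mul [].
Qed.

Lemma dvdm_refl x : x %| x.
Proof. by exists 1; rewrite mulg1. Qed.

Lemma dvd1m x : 1 %| x.
Proof. by exists x; rewrite mul1g. Qed.

Lemma dvdm_trans y x z : x %| y -> y %| z -> x %| z.
Proof. by move=> [a ->] [b ->]; exists (a * b); rewrite mulgA. Qed.

Lemma dvdm_mulr x y : x %| x * y.
Proof. by exists y. Qed.

Lemma dvdm_mull x y : y %| x * y.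
Proof. by exists x; rewrite mulmC. Qed.

Lemma dvdm_mul x y a b : x %| a -> y %| b -> x * y %| a * b.
Proof. by move=> [c ->] [d ->]; exists (c * d); rewrite mulmACA. Qed.

Lemma dvdm_cancel c a b : ~ zeros H c -> c * a %| c * b -> a %| b.
Proof. by move=> nc [u]; rewrite -mulgA => /(mulmI _ nc) ->; exists u. Qed.

Lemma dvdm_zero x z : zeros H z -> x %| z.
Proof. by move=> zz; exists z; rewrite mulmC zz. Qed.

Lemma dvdm_nonzero x y : x %| y -> ~ zeros H y -> ~ zeros H x.
Proof. by move=> [c ->] ny zx; apply: ny; apply: zerosMl. Qed.

Definition multiples d : set H := [set x | d %| x].

Definition is_ideal (X : set H) :=
  zeros H `<=` X /\ forall x y, X x -> X (x * y).

Lemma ideal_dvd X x y : is_ideal X -> X x -> x %| y -> X y.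
Proof. by move=> [_ XM] Xx [c ->]; apply: XM. Qed.

Lemma multiples_ideal d : is_ideal (multiples d).
Proof.
split=> [z|x y]; first exact: dvdm_zero.
by move=> dx; apply: (dvdm_trans dx); apply: dvdm_mulr.
Qed.

Lemma multiples_sub (X : set H) d : is_ideal X -> X d -> multiples d `<=` X.
Proof. by move=> iX Xd x; apply: ideal_dvd. Qed.

Lemma zeros_ideal : is_ideal (zeros H).
Proof. by split=> // x y; apply: zerosMl. Qed.

Lemma principal_idealP (P : set H) : principal_ideal P <->
  P = zeros H \/ exists2 d, ~ zeros H d & P = multiples d.
Proof.
split=> [[A A1 ->]|[->|[d nd ->]]]; last 2 first.
- exists set0; first by move=> ? ? [].
  rewrite seteqP; split=> [x zx|x [[? []]|//]].
  by right.
- exists [set d]; first by move=> x y -> ->.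
  rewrite seteqP; split=> [x [c ->]|x [[_ -> [c _ <-]]|/(dvdm_zero d) //]].
    by left; exists d => //; exists c.
  exact: dvdm_mulr.
have [[d Ad nd]|Az] := pselect (exists2 d, A d & ~ zeros H d).
  right; exists d => //; rewrite seteqP; split=> x.
    by move=> [[a Aa [c _ <-]]|/(dvdm_zero d) //]; rewrite (A1 _ _ Aa Ad); exists c.
  by move=> [c ->]; left; exists d => //; exists c.
left; rewrite seteqP; split=> x; last by right.
move=> [[a Aa [c _ <-]]|//]; apply: zerosMl; apply: contrapT => na.
by apply: Az; exists a.
Qed.

(** Divisibility is the reverse of inclusion of principal ideals, so an ideal
    is directed when it is a directed union of principal ideals. *)
Definition directed (X : set H) :=
  forall x y, X x -> X y -> exists d, [/\ X d, d %| x & d %| y].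

Lemma directed_seq (X : set H) x (s : seq H) : directed X -> X x ->
  (forall y, y \in s -> X y) ->
  exists d, [/\ X d, d %| x & forall y, y \in s -> d %| y].
Proof.
move=> dX Xx; elim: s => [|y s IHs] Xs.
  by exists x; split=> //; apply: dvdm_refl.
have [|d [Xd dx ds]] := IHs; first by move=> w ws; apply: Xs; rewrite inE ws orbT.
have [e [Xe ed ey]] := dX _ _ Xd (Xs y (mem_head _ _)).
exists e; split=> // [|w]; first exact: dvdm_trans dx.
by rewrite inE => /predU1P [-> //|/ds]; apply: dvdm_trans.
Qed.

End Divisibility.

(** * The closure operations in terms of divisibility *)

Section Closures.
Variable H : nzCancMonoidType.
Implicit Types (a b c d e u x y z : H) (X Y I : set H) (s : seq H).

(** The elements of (X^-1)^-1: the fraction a/u lies in X^-1 exactly when u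
    divides a y for all y in X. *)
Definition v_implied X x := forall a u, ~ zeros H u ->
  (forall y, X y -> u %| a * y) -> u %| a * x.

Lemma range_fracE a (s : nonzero H) y :
  range (@emb H) (frac a s * emb y) <-> val s %| a * y.
Proof.
have -> : frac a s * emb y = frac (a * y) s.
  by rewrite [LHS]qmulE; apply/fracE => /=; rewrite mulg1.
split=> [[x _ /fracE /=]|[c ac]].
  by rewrite mulg1 => <-; exists x; rewrite mulmC.
by exists c => //; apply/fracE => /=; rewrite mulg1 mulmC.
Qed.

Lemma v_closureE X x : v_closure X x <-> v_implied X x.
Proof.
split=> [vX a u nu Xu|vX z zX].
  have nu' : u \notin zeros H by apply/negP => /set_mem.
  apply/(range_fracE a (Sub u nu')); rewrite qmulC; apply: vX => _ [y Xy <-].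
  exact/range_fracE/Xu.
have [a [s zE]] := fracP z; rewrite zE qmulC.
apply/range_fracE/vX => [zs|y Xy].
  by have /negP := valP s; apply; apply/mem_set.
by apply/range_fracE; rewrite -zE; apply: zX; exists y.
Qed.

Lemma emb_surjectiveP : range (@emb H) = setT <-> forall u x, ~ zeros H u -> u %| x.
Proof.
split=> [HT u x nu|HG].
  have nu' : u \notin zeros H by apply/negP => /set_mem.
  have /range_fracE : range (@emb H) (frac x (Sub u nu') * emb 1) by rewrite HT.
  by rewrite mulg1.
rewrite seteqP; split=> // z _; have [a [s ->]] := fracP z.
have -> : frac a s = frac a s * emb 1 by rewrite emb1 mulg1.
apply/range_fracE/HG => zs.
by have /negP := valP s; apply; apply/mem_set.
Qed.

(** This description does not depend on whether H is its own quotient monoid,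
    because v-closures are only taken of finite sets with a nonzero element.
    If every nonzero element is a unit, such a set has v-closure H; otherwise the
    v-closure of a set without nonzero elements consists of the zeros. *)
Lemma t_closureP X x : t_closure X x <-> zeros H x \/
  exists s, [/\ forall y, y \in s -> X y,
    exists2 e, e \in s & ~ zeros H e & v_implied [set` s] x].
Proof.
rewrite /t_closure; case: asboolP => [/emb_surjectiveP HG|HnG].
  case: asboolP => [Xz|/existsNP [e /not_implyP [Xe ne]]].
    by split=> [|[//|[s [Xs [e es]]]]]; [left|case; apply/Xz/Xs].
  split=> // _; right; exists [:: e]; split; first by move=> y /[1!inE] /eqP ->.
    by exists e; rewrite ?mem_head.
  by move=> a u nu _; apply: HG.
split=> [[E [EX /finite_seqP [s Es]] /v_closureE vx]|]; last first.
  case=> [zx|[s [Xs _ vx]]].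
    exists set0; first by split.
    by apply/v_closureE => a u _ _; apply/dvdm_zero/zerosMr.
  exists [set` s]; last exact/v_closureE.
  by split=> [y /Xs //|]; apply/finite_seqP; exists s.
subst E; have [[e es ne]|sz] := pselect (exists2 e, e \in s & ~ zeros H e).
  by right; exists s; split=> //; exists e.
(* A nonzero x in the v-closure of a set of zeros is divisible by u x for
   every nonzero u, and so is w x for every w: all nonzero u are units. *)
left; apply: contrapT => nx; apply: HnG; apply/emb_surjectiveP => u w nu.
apply: (@dvdm_cancel _ x) => //; rewrite ![x * _]mulmC; apply: vx.
  by move=> /zeros_mul [].
move=> y ys; apply/dvdm_zero/zerosMr; apply: contrapT => ny.
by apply: sz; exists y.
Qed.

Lemma v_implied_sub X Y x : X `<=` Y -> v_implied X x -> v_implied Y x.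
Proof. by move=> XY vx a u nu uY; apply: vx => // y /XY; apply: uY. Qed.

Lemma v_implied_in X x : X x -> v_implied X x.
Proof. by move=> Xx a u _; apply. Qed.

Lemma v_implied_mulr X x y : v_implied X x -> v_implied X (x * y).
Proof.
by move=> vx a u nu uX; rewrite mulgA; apply: dvdm_trans (dvdm_mulr _ _); apply: vx.
Qed.

Lemma v_implied_zero X z : zeros H z -> v_implied X z.
Proof. by move=> zz a u _ _; apply/dvdm_zero/zerosMr. Qed.

Lemma v_implied_trans X Y x :
  (forall y, Y y -> v_implied X y) -> v_implied Y x -> v_implied X x.
Proof. by move=> XY Yx a u nu uX; apply: Yx => // y /XY; apply. Qed.

Lemma t_closure_ideal X : is_ideal (t_closure X).
Proof.
split=> [z zz|x y]; first by apply/t_closureP; left.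
move=> /t_closureP [zx|[s [sX es vx]]]; apply/t_closureP; last right.
  by left; apply: zerosMl.
by exists s; split=> //; apply: v_implied_mulr.
Qed.

Lemma t_closure_sub X : X `<=` t_closure X.
Proof.
move=> x Xx; apply/t_closureP; have [|nx] := pselect (zeros H x); first by left.
right; exists [:: x]; split=> [y /[1!inE] /eqP -> //||].
  by exists x; rewrite ?mem_head.
by apply: v_implied_in; rewrite /= mem_head.
Qed.

Lemma t_closure_mono X Y : X `<=` Y -> t_closure X `<=` t_closure Y.
Proof.
move=> XY x /t_closureP [zx|[s [sX es vx]]]; apply/t_closureP; first by left.
by right; exists s; split=> // y /sX /XY.
Qed.

Lemma t_closure_nonzero X x : t_closure X x -> ~ zeros H x ->
  exists2 e, X e & ~ zeros H e.
Proof. by move=> /t_closureP [//|[s [sX [e es ne] _]]] _; exists e; first exact: sX. Qed.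

(** Finitely many elements of the t-closure of X depend on finitely many
    elements of X altogether, which reduces the claim to the idempotence of
    the v-closure. *)
Lemma t_closure_idem X : t_closure (t_closure X) = t_closure X.
Proof.
rewrite seteqP; split; last exact: t_closure_sub.
move=> x /t_closureP [zx|[s [sX [e es ne] vx]]]; first by apply/t_closureP; left.
have [e' Xe' ne'] := t_closure_nonzero (sX e es) ne.
have [u [uX us]] : exists u : seq H, (forall y, y \in u -> X y) /\
    forall y, y \in s -> v_implied [set` u] y.
  elim: s sX {es vx} => [_|y s IHs ysX]; first by exists [::].
  have [|u [uX us]] := IHs; first by move=> w ws; apply: ysX; rewrite inE ws orbT.
  have [zy|[v [vX _ vy]]] := (t_closureP _ _).1 (ysX y (mem_head _ _)).
    exists u; split=> // w /[1!inE] /predU1P [->|/us //].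
    exact: v_implied_zero.
  exists (u ++ v); split=> [w|w /[1!inE] /predU1P [->|/us]].
  - by rewrite mem_cat => /orP [/uX|/vX].
  - by apply: v_implied_sub vy => w' /=; rewrite mem_cat => ->; rewrite orbT.
  - by apply: v_implied_sub => w' /=; rewrite mem_cat => ->.
apply/t_closureP; right; exists (e' :: u); split.
- by move=> y /[1!inE] /predU1P [->|/uX].
- by exists e'; rewrite ?mem_head.
apply: v_implied_trans vx => y /us; apply: v_implied_sub => w /=.
by rewrite inE => ->; rewrite orbT.
Qed.

(** A directed ideal contains, with a finite set, a common divisor d of it, and
    the v-closure of the set stays inside dH. *)
Lemma directed_t_ideal X : is_ideal X -> directed X -> r_ideal (@t_closure H) X.
Proof.
move=> iX dX; rewrite /r_ideal seteqP; split; last exact: t_closure_sub.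
move=> x /t_closureP [zx|[s [sX [e es ne] vx]]]; first exact: iX.1.
have [d [Xd de ds]] := directed_seq dX (sX e es) sX.
apply: (ideal_dvd iX Xd); rewrite -(mul1g x); apply: vx.
  exact: dvdm_nonzero de ne.
by move=> y /ds; rewrite mul1g.
Qed.

Lemma t_closure_multiples d : t_closure (multiples d) = multiples d.
Proof.
apply: directed_t_ideal; first exact: multiples_ideal.
by move=> x y dx dy; exists d; split=> //; apply: dvdm_refl.
Qed.

(** * The w-closure *)

Definition span X := mulset X setT `|` zeros H.

(** The largest F that can witness that x lies in the w-closure of X. *)
Definition colon X x := [set y | span X (x * y)].

Lemma span_ideal X : is_ideal (span X).
Proof.
split=> [z|x y]; first by right.
move=> [[a Xa [c _ <-]]|zx]; last by right; apply: zerosMl.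
by left; exists a => //; exists (c * y) => //; rewrite mulgA.
Qed.

Lemma span_sub X : X `<=` span X.
Proof. by move=> x Xx; left; exists x => //; exists 1; rewrite ?mulg1. Qed.

Lemma span_min X Y : X `<=` Y -> is_ideal Y -> span X `<=` Y.
Proof.
move=> XY iY x [[a /XY Xa [c _ <-]]|]; last exact: iY.1.
exact: iY.2.
Qed.

Lemma w_closureP X x : w_closure X x <-> t_closure (colon X x) 1.
Proof.
split=> [[F xF FT]|tF].
  suff : t_closure F `<=` t_closure (colon X x) by apply; rewrite FT.
  by apply: t_closure_mono => y Fy; apply: xF; exists x => //; exists y.
exists (colon X x); first by move=> _ [_ -> [y Fy <-]].
rewrite seteqP; split=> // y _; rewrite -(mul1g y).
exact: (t_closure_ideal _).2.
Qed.

Lemma w_closure_ideal X : is_ideal (w_closure X).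
Proof.
split=> [z zz|x y /w_closureP tx]; apply/w_closureP.
  by apply: t_closure_sub; right; apply: zerosMl.
apply: t_closure_mono tx => w; rewrite /colon /= mulmAC.
exact: (span_ideal _).2.
Qed.

Lemma w_closure_sub X : X `<=` w_closure X.
Proof.
move=> x Xx; apply/w_closureP/t_closure_sub; rewrite /colon /= mulg1.
exact: span_sub.
Qed.

Lemma w_closure_mono X Y : X `<=` Y -> w_closure X `<=` w_closure Y.
Proof.
move=> XY x /w_closureP tx; apply/w_closureP; apply: t_closure_mono tx => y.
apply: span_min; last exact: span_ideal.
by move=> w /XY; apply: span_sub.
Qed.

Lemma t_closure_mul X a y : t_closure X y ->
  t_closure [set a * x | x in X] (a * y).
Proof.
have [za _|na] := pselect (zeros H a).
  by apply/t_closureP; left; apply: zerosMl.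
move=> /t_closureP [zy|[s [sX [e es ne] vy]]].
  by apply/t_closureP; left; apply: zerosMr.
apply/t_closureP; right; exists [seq a * x | x <- s]; split.
- by move=> _ /mapP [x /sX Xx ->]; exists x.
- by exists (a * e); [apply: map_f|move=> /zeros_mul []].
move=> b u nu us; rewrite mulgA; apply: vy => // x xs.
by rewrite -mulgA; apply: us; apply: map_f.
Qed.

(** Since 1 lies in the t-closure of the colon set of x, the element x lies in
    the t-closure of x times that set, whose elements are multiples of
    elements of X. *)
Lemma w_closure_sub_t X : w_closure X `<=` t_closure X.
Proof.
move=> x /w_closureP tx; rewrite -(mulg1 x) -[t_closure X]t_closure_idem.
apply: t_closure_mono (t_closure_mul x tx) => _ [y cy <-]; move: cy.
by apply: span_min; [apply: t_closure_sub|apply: t_closure_ideal].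
Qed.

(** If y x lies in the w-closure of X, then y times the colon set of y x is
    contained in the colon set of x, and so y lies in the t-closure of the
    latter. *)
Lemma w_closure_idem X : w_closure (w_closure X) = w_closure X.
Proof.
rewrite seteqP; split; last exact: w_closure_sub.
move=> x /w_closureP tx; apply/w_closureP.
rewrite -[t_closure _]t_closure_idem; apply: t_closure_mono tx => y /=.
move=> /span_min -/(_ _ (@subset_refl _ _) (w_closure_ideal _)).
move=> /w_closureP ty; rewrite -(mulg1 y).
apply: t_closure_mono (t_closure_mul y ty) => _ [w cw <-].
by rewrite /colon /= mulgA.
Qed.

(** The properties shared by the t- and the w-closure on which the consequences
    of the Bezout property rest. *)
Definition finer_than_t (r : set H -> set H) :=
  [/\ forall X, is_ideal (r X), forall X, X `<=` r X,
      forall X, r (r X) = r X & forall X, r X `<=` t_closure X].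

Lemma t_finer : finer_than_t (@t_closure H).
Proof.
split; [exact: t_closure_ideal|exact: t_closure_sub|exact: t_closure_idem|].
by move=> X.
Qed.

Lemma w_finer : finer_than_t (@w_closure H).
Proof.
split; [exact: w_closure_ideal|exact: w_closure_sub|exact: w_closure_idem|].
exact: w_closure_sub_t.
Qed.

(** * Bezout monoids and greatest common divisors *)

Lemma Bezout_generator r s e : finer_than_t r -> r_Bezout_monoid r ->
  e \in s -> ~ zeros H e ->
  exists2 d, ~ zeros H d & r [set` s] = multiples d.
Proof.
move=> [ri rs rr _] rB es ne.
have re : r [set` s] e by apply: rs.
have /principal_idealP [rz|//] : principal_ideal (r [set` s]).
  apply: rB; first by split=> [|rz]; [exact: (ri _).1|apply/ne/rz].
  split; first exact: rr.
  by exists [set` s]; split=> //; apply/finite_seqP; exists s.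
by case: ne; rewrite -rz.
Qed.

Lemma t_closure_v s x : t_closure [set` s] x -> v_implied [set` s] x.
Proof.
move=> /t_closureP [|[u [us _]]]; first exact: v_implied_zero.
exact: v_implied_sub.
Qed.

(** For finite E, the w-closure of E is a principal ideal, hence t-closed, and so
    contains the t-closure of E. *)
Lemma w_eq_t_of_w_Bezout : r_Bezout_monoid (@w_closure H) ->
  @w_closure H = @t_closure H.
Proof.
move=> wB; apply/funext => X; rewrite seteqP; split; first exact: w_closure_sub_t.
move=> x /t_closureP [zx|[s [sX [e es ne] vx]]]; first exact: (w_closure_ideal _).1.
have [d _ wd] := Bezout_generator w_finer wB es ne.
apply: (@w_closure_mono [set` s]) => //; rewrite wd -t_closure_multiples -wd.
apply: (t_closure_mono (@w_closure_sub _)); apply/t_closureP; right.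
by exists s; split=> //; exists e.
Qed.

(** If dH is the t-closure of a finite set E, the set of quotients of E by d has
    t-closure H and so puts d into the w-closure of E. *)
Lemma w_eq_t_of_t_Bezout : r_Bezout_monoid (@t_closure H) ->
  @w_closure H = @t_closure H.
Proof.
move=> tB; apply/funext => X; rewrite seteqP; split; first exact: w_closure_sub_t.
move=> x /t_closureP [zx|[s [sX [e es ne] vx]]]; first exact: (w_closure_ideal _).1.
have [d nd td] := Bezout_generator t_finer tB es ne.
have ds y : y \in s -> d %| y.
  by move=> ys; change (multiples d y); rewrite -td; apply: t_closure_sub.
have dx : d %| x.
  change (multiples d x); rewrite -td; apply/t_closureP; right.
  by exists s; split=> //; exists e.
have vd : v_implied [set` s] d.
  by apply: t_closure_v; rewrite td; apply: dvdm_refl.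
apply: (ideal_dvd (w_closure_ideal X)) dx.
have [f fE] : exists f : H -> H, forall y, y \in s -> y = d * f y.
  have /choice [f fE] : forall y, exists c, y \in s -> y = d * c.
    move=> y; have [/ds [c ->]|] := boolP (y \in s); first by exists c.
    by exists 1.
  by exists f.
apply/w_closureP/t_closureP; right; exists [seq f y | y <- s]; split.
- move=> _ /mapP [y ys ->]; rewrite /colon /= -(fE y ys); exact/span_sub/sX.
- by exists (f e); [exact: map_f|move=> ze; apply: ne; rewrite (fE e es); exact: zerosMr].
move=> a u nu us; rewrite mulg1; apply: (@dvdm_cancel _ d) => //.
rewrite [d * a]mulmC; apply: vd => [|y ys]; first by move=> /zeros_mul [].
by rewrite (fE y ys) mulmCA; apply: dvdm_mul; [exact: dvdm_refl|exact/us/map_f].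
Qed.

(** The third condition involves every factor a, not only a = 1, because an
    ordinary gcd need not be compatible with multiplication. *)
Definition has_gcds := forall x y, exists d,
  [/\ d %| x, d %| y & v_implied [set x; y] d].

Lemma gcds_of_t_Bezout : r_Bezout_monoid (@t_closure H) -> has_gcds.
Proof.
move=> tB x y.
have [[e es ne]|xyz] := pselect (exists2 e, e \in [:: x; y] & ~ zeros H e).
  have [d _ td] := Bezout_generator t_finer tB es ne; exists d; split.
  - by change (multiples d x); rewrite -td; apply: t_closure_sub; rewrite /= mem_head.
  - by change (multiples d y); rewrite -td; apply: t_closure_sub; rewrite /= !inE eqxx orbT.
  have /t_closure_v : t_closure [set` [:: x; y]] d by rewrite td; apply: dvdm_refl.
  apply: v_implied_sub => w /=; rewrite !inE => /orP [] /eqP ->; first by left.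
  by right.
exists x; split; first exact: dvdm_refl.
  apply: dvdm_zero; apply: contrapT => ny; apply: xyz.
  by exists y; rewrite // !inE eqxx orbT.
by apply: v_implied_in; left.
Qed.

Lemma t_ideal_directed X : has_gcds -> r_ideal (@t_closure H) X -> directed X.
Proof.
move=> gcds tX x y Xx Xy.
have [[e es ne]|xyz] := pselect (exists2 e, e \in [:: x; y] & ~ zeros H e).
  have [d [dx dy vd]] := gcds x y; exists d; split=> //; rewrite -tX.
  apply/t_closureP; right; exists [:: x; y]; split.
  - by move=> w; rewrite !inE => /orP [] /eqP ->.
  - by exists e.
  by apply: v_implied_sub vd => w /= [] ->; rewrite !inE eqxx ?orbT.
exists x; split=> //; first exact: dvdm_refl.
apply: dvdm_zero; apply: contrapT => ny; apply: xyz.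
by exists y; rewrite // !inE eqxx orbT.
Qed.

Lemma t_ideal_ideal X : r_ideal (@t_closure H) X -> is_ideal X.
Proof. by move=> <-; apply: t_closure_ideal. Qed.

Lemma t_Bezout_of_gcds : has_gcds -> r_Bezout_monoid (@t_closure H).
Proof.
move=> gcds I [zI /existsNP [x /not_implyP [Ix nx]]] [tI [E [Efin EI IE]]].
have [s sE] := (finite_seqP _).1 Efin; apply/principal_idealP; right.
have [|d [Id dx ds]] := @directed_seq _ I x s (t_ideal_directed gcds tI) Ix.
  by move=> y ys; apply: EI; rewrite sE.
exists d; first exact: dvdm_nonzero dx nx.
rewrite seteqP; split; last exact: multiples_sub (t_ideal_ideal tI) Id.
rewrite IE -(t_closure_multiples d); apply: t_closure_mono => y.
by rewrite sE => /ds.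
Qed.

Definition is_lcm x y m := forall z, m %| z <-> x %| z /\ y %| z.

Definition has_lcms := forall x y, ~ zeros H x -> ~ zeros H y ->
  exists m, is_lcm x y m.

(** The lcm is x y / d: a common multiple z of x and y makes x y divide both
    z x and z y, hence z d. *)
Lemma lcms_of_gcds : has_gcds -> has_lcms.
Proof.
move=> gcds x y nx ny; have [d [[x' xE] [y' yE] vd]] := gcds x y.
have nd : ~ zeros H d by apply: dvdm_nonzero nx; exists x'.
exists (x * y') => z; split=> [mz|[[u zE] [v zE']]].
  split; apply: dvdm_trans mz; first exact: dvdm_mulr.
  by rewrite xE mulmAC -yE; apply: dvdm_mulr.
apply: (@dvdm_cancel _ d) => //; rewrite mulmCA -yE [d * z]mulmC; apply: vd.
  by move=> /zeros_mul [].
move=> w [->|->]; last by rewrite zE mulmAC; apply: dvdm_mulr.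
by rewrite (mulmC x) zE' mulmAC; apply: dvdm_mulr.
Qed.

(** The gcd is x y / m with m the lcm.  If u divides a x and a y, write a x = u p
    and a y = u q; then a x y = u p y = u x q makes p y = x q a common multiple
    of x and y, hence a multiple of m, and a d m = a x y gives u | a d. *)
Lemma gcds_of_lcms : has_lcms -> has_gcds.
Proof.
move=> lcms x y; have [zx|nx] := pselect (zeros H x).
  exists y; split; [exact: dvdm_zero|exact: dvdm_refl|].
  by apply: v_implied_in; right.
have [zy|ny] := pselect (zeros H y).
  exists x; split; [exact: dvdm_refl|exact: dvdm_zero|].
  by apply: v_implied_in; left.
have [m mP] := lcms x y nx ny.
have [[u mE] [v mE']] := (mP m).1 (dvdm_refl m).
have [d xyE] : m %| x * y by apply/mP; split; [exact: dvdm_mulr|exact: dvdm_mull].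
have nm : ~ zeros H m.
  by apply: (@dvdm_nonzero _ _ (x * y)); [exists d|move=> /zeros_mul []].
exists d; split.
- exists v; apply: (mulmI _ ny).
  by rewrite mulmC xyE mE' -mulgA (mulmC v).
- exists u; apply: (mulmI _ nx).
  by rewrite xyE mE -mulgA (mulmC u).
move=> a b nb bxy.
have [p pE] : b %| a * x by apply: bxy; left.
have [q qE] : b %| a * y by apply: bxy; right.
have pq : p * y = x * q.
  by apply: (mulmI _ nb); rewrite mulgA -pE [RHS]mulmCA -qE mulmCA mulgA.
have [w wE] : m %| p * y.
  by apply/mP; split; [rewrite pq; exact: dvdm_mulr|exact: dvdm_mull].
exists w; apply: (mulmI _ nm).
by rewrite mulmCA -xyE mulgA pE -mulgA wE mulmCA.
Qed.

End Closures.

(** * Radicals of ideals *)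

Section Radicals.
Variable H : nzCancMonoidType.
Implicit Types (a b c d e p q r x y z : H) (X Y I J P : set H).

Lemma radical_sub X : X `<=` radical X.
Proof. by move=> x Xx; exists 1%N => //; rewrite expg1. Qed.

Lemma radical_mono X Y : X `<=` Y -> radical X `<=` radical Y.
Proof. by move=> XY x [n n0 /XY Yx]; exists n. Qed.

Lemma radical_idem X : is_radical (radical X).
Proof.
rewrite /is_radical seteqP; split; last exact: radical_sub.
move=> x [m m0 [n n0 Xx]]; exists (m * n)%N; first by rewrite muln_gt0 m0.
by rewrite expgnA.
Qed.

Lemma radical_min X Y : is_radical Y -> X `<=` Y -> radical X `<=` Y.
Proof. by move=> <-; rewrite -[X in _ -> _ `<=` X]radical_idem; apply: radical_mono. Qed.

Lemma radical_ideal X : is_ideal X -> is_ideal (radical X).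
Proof.
move=> [zX XM]; split=> [z /zX|x y [n n0 Xx]]; first exact: radical_sub.
by exists n => //; rewrite expmMn; apply: XM.
Qed.

Lemma radical_zeros : radical (zeros H) = zeros H.
Proof.
rewrite seteqP; split; last exact: radical_sub.
by move=> x [n _ /zeros_exp].
Qed.

(** * Coprimality and radical elements *)

(** For nonzero a and c this says that the intersection of aH and cH is acH,
    that is, that the v-closure of the set of a and c is H. *)
Definition coprime a c := forall v, a %| c * v -> a %| v.

(** A common multiple x of a and c has x^2 in acH, hence x in acH. *)
Lemma coprime_of_radical a c : ~ zeros H c ->
  is_radical (multiples (a * c)) -> coprime a c.
Proof.
move=> nc rac v [u cvE]; apply: (@dvdm_cancel _ c) => //.
have : multiples (a * c) (c * v).
  rewrite -rac; exists 2 => //; exists (u * v).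
  by rewrite expg2 {1}cvE mulmACA.
by rewrite /multiples /= mulmC.
Qed.

Lemma coprime_expr a c n : coprime a c -> coprime a (c ^+ n).
Proof.
move=> cop; elim: n => [|n IHn] v; first by rewrite mul1g.
by rewrite expgS -mulgA => /cop /IHn.
Qed.

Lemma coprime_expl a c n : ~ zeros H a -> coprime a c -> coprime (a ^+ n) c.
Proof.
move=> na cop; elim: n => [|n IHn] v; first by move=> _; apply: dvd1m.
rewrite expgS => acv; have [|u uE] := cop v.
  by apply: dvdm_trans acv; apply: dvdm_mulr.
rewrite uE in acv *; apply: dvdm_mul; first exact: dvdm_refl.
by apply: IHn; apply: (dvdm_cancel na); rewrite mulmCA.
Qed.

(** If a = b d and b | c v, then a | c (d v), so a | d v and b | v. *)
Lemma coprime_dvd a b c : ~ zeros H a -> b %| a -> coprime a c -> coprime b c.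
Proof.
move=> na [d aE] cop v bcv; have nd : ~ zeros H d.
  by move=> zd; apply: na; rewrite aE; apply: zerosMr.
apply: (dvdm_cancel nd); rewrite mulmC -aE; apply: cop.
by rewrite aE mulmCA (mulmC b); apply: dvdm_mul => //; apply: dvdm_refl.
Qed.

Definition radical_of a r := radical (multiples a) = multiples r.

Lemma radical_ofP a r : radical_of a r -> r %| a /\ exists n, a %| r ^+ n.+1.
Proof.
move=> ar; split; first by change (multiples r a); rewrite -ar; apply/radical_sub/dvdm_refl.
have : radical (multiples a) r by rewrite ar; apply: dvdm_refl.
by move=> [[//|n] _ an]; exists n.
Qed.

Lemma radical_of_dvd a b r q : radical_of a r -> radical_of b q ->
  b %| a -> q %| r.
Proof.
move=> ar bq ba; change (multiples q r); rewrite -bq.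
have : radical (multiples a) r by rewrite ar; apply: dvdm_refl.
by apply: radical_mono => x; apply: dvdm_trans.
Qed.

(** Applied to the generators r and q of the radicals of an element and of one
    of its divisors. *)
Lemma radical_of_coprime r q e : ~ zeros H r -> is_radical (multiples r) ->
  r = q * e -> coprime q e.
Proof.
move=> nr rr rE; apply: coprime_of_radical; rewrite -?rE // => ze.
by apply: nr; rewrite rE; apply: zerosMr.
Qed.

Lemma radical_of_radical a r : radical_of a r -> is_radical (multiples r).
Proof. by move=> <-; apply: radical_idem. Qed.

Lemma coprime_radical_of b q e n : ~ zeros H q -> radical_of b q ->
  coprime q e -> coprime b (e ^+ n).
Proof.
move=> nq bq cop; have [_ [m bm]] := radical_ofP bq.
apply: (coprime_dvd _ bm); first by move/zeros_exp.
exact/coprime_expl/coprime_expr.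
Qed.

(** Let r = q e.  Cancelling r leaves b | r^n = q^n e^n, and b is coprime to e
    because it divides a power of q. *)
Lemma radical_cofactor_exp r b q n : ~ zeros H (r * b) ->
  radical_of (r * b) r -> radical_of b q ->
  r * b %| r ^+ n.+1 -> b %| q ^+ n.
Proof.
move=> nrb rbr bq; rewrite expgS.
have nr : ~ zeros H r by move=> zr; apply: nrb; apply: zerosMl.
move=> /(dvdm_cancel nr).
have [e rE] := radical_of_dvd rbr bq (dvdm_mull r b).
have nq : ~ zeros H q by move=> zq; apply: nr; rewrite rE; apply: zerosMl.
rewrite {1}rE expmMn mulmC.
apply: (coprime_radical_of nq bq).
exact: radical_of_coprime (radical_of_radical rbr) rE.
Qed.

(** Division by the radical is monotone.  Let r = r' e; cancelling r' leaves
    b' | e b, and b' is coprime to e because it divides a power of r'. *)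
Lemma radical_cofactor_dvd r b r' b' : ~ zeros H (r * b) ->
  radical_of (r * b) r -> radical_of (r' * b') r' ->
  r' * b' %| r * b -> b' %| b.
Proof.
move=> nrb rbr rbr' bb.
have nr : ~ zeros H r by move=> zr; apply: nrb; apply: zerosMl.
have [e rE] := radical_of_dvd rbr rbr' bb.
have nr' : ~ zeros H r' by move=> zr; apply: nr; rewrite rE; apply: zerosMl.
have cop : coprime r' e.
  exact: radical_of_coprime (radical_of_radical rbr) rE.
have [_ [m bm]] := radical_ofP rbr'.
suff : coprime b' e.
  apply; apply: (dvdm_cancel nr'); rewrite mulgA -rE.
  exact: bb.
apply: (@coprime_dvd (r' ^+ m.+1)); first by move/zeros_exp.
  exact: dvdm_trans (dvdm_mull _ _) bm.
exact: coprime_expl.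
Qed.

Definition has_radicals := forall a, ~ zeros H a -> exists r, radical_of a r.

(** Dividing a repeatedly by the generator of its radical reaches a unit: if a
    divides the n-th power of that generator, n steps are enough. *)
Lemma radical_ind (Q : H -> Prop) : has_radicals ->
  (forall a, a %| 1 -> Q a) ->
  (forall r b, ~ zeros H (r * b) -> radical_of (r * b) r -> Q b -> Q (r * b)) ->
  forall a, ~ zeros H a -> Q a.
Proof.
move=> rads Q1 QM a na; have [r ar] := rads a na.
have [_ [n]] := radical_ofP ar; elim: {n}n.+1 a r na ar => [|n IHn] a r na ar an.
  exact: Q1.
have [[b aE] _] := radical_ofP ar; rewrite aE in na ar an *.
have nb : ~ zeros H b by move=> zb; apply: na; apply: zerosMr.
have [q bq] := rads b nb; apply: QM => //; apply: (IHn b q) => //.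
exact: radical_cofactor_exp an.
Qed.

(** * Least common multiples from radicals *)

Lemma is_lcm_sym x y m : is_lcm x y m -> is_lcm y x m.
Proof. by move=> xym z; rewrite xym; split=> [] []. Qed.

Lemma is_lcm_nonzero x y m : ~ zeros H x -> ~ zeros H y -> is_lcm x y m ->
  ~ zeros H m.
Proof.
move=> nx ny xym; apply: (@dvdm_nonzero _ _ (x * y)) => [|/zeros_mul []//].
by apply/xym; split; [apply: dvdm_mulr|apply: dvdm_mull].
Qed.

(** Taking lcms factor by factor: if lcm(a, y) = a u, then lcm(a x, y) is a
    times lcm(x, u). *)
Lemma is_lcm_mul a x y u m : ~ zeros H a -> is_lcm a y (a * u) ->
  is_lcm x u m -> is_lcm (a * x) y (a * m).
Proof.
move=> na ayu xum z; split=> [amz|[axz yz]].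
  have [xm um] := (xum m).1 (dvdm_refl m).
  split; first by apply: dvdm_trans amz; apply: dvdm_mul => //; apply: dvdm_refl.
  have : a * u %| z.
    by apply: dvdm_trans amz; apply: dvdm_mul => //; apply: dvdm_refl.
  by move=> /ayu [].
have /ayu [w zE] : a %| z /\ y %| z.
  by split=> //; apply: dvdm_trans axz; apply: dvdm_mulr.
move: axz; rewrite zE -mulgA => /(dvdm_cancel na) xuw.
apply: dvdm_mul; first exact: dvdm_refl.
by apply/xum; split=> //; apply: dvdm_mulr.
Qed.

Lemma unit_lcm x y : x %| 1 -> is_lcm x y y.
Proof.
move=> x1 z; split=> [yz|[] //]; split=> //.
exact: dvdm_trans x1 (dvd1m z).
Qed.

(** If x divides z^n with n > 0, then x y divides (z y)^n. *)
Lemma is_radical_divisor x y : ~ zeros H y -> is_radical (multiples (x * y)) ->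
  is_radical (multiples x).
Proof.
move=> ny rxy; rewrite /is_radical seteqP; split; last exact: radical_sub.
move=> z [[//|n] _ xz]; apply: (dvdm_cancel ny); rewrite ![y * _]mulmC.
change (multiples (x * y) (z * y)); rewrite -rxy; exists n.+1 => //.
rewrite expmMn expgS; apply: dvdm_mul; last by rewrite expgS; apply: dvdm_mulr.
by rewrite -expgS.
Qed.

(** A common multiple z of a and b has z^2 in abH. *)
Lemma radical_lcm a b m : is_radical (multiples a) -> is_radical (multiples b) ->
  radical_of (a * b) m -> is_lcm a b m.
Proof.
move=> ra rb abm z; have [mab _] := radical_ofP abm.
change (multiples m z <-> multiples a z /\ multiples b z).
rewrite -abm; split=> [abz|[az bz]].
  have ab_min c : is_radical (multiples c) -> c %| a * b -> multiples c z.
    move=> rc cab; move: abz; apply: radical_min => // w.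
    exact: dvdm_trans.
  by split; apply: ab_min => //; [exact: dvdm_mulr|exact: dvdm_mull].
by exists 2 => //; rewrite expg2; apply: dvdm_mul.
Qed.

(** The lcm of two radical elements exists by [radical_lcm] and is radical.
    Two inductions along [radical_ind] extend this to a radical element and an
    arbitrary one, then to two arbitrary elements.  In the first, replacing a
    by the quotient u of lcm(q, a) by q keeps it radical. *)
Lemma lcms_of_radicals : has_radicals -> has_lcms H.
Proof.
move=> rads; have radlcm b : ~ zeros H b -> forall a, ~ zeros H a ->
    is_radical (multiples a) -> exists m, is_lcm b a m.
  move: b; apply: (@radical_ind (fun b => forall a, ~ zeros H a ->
    is_radical (multiples a) -> exists m, is_lcm b a m) rads)
      => [b b1 a _ _|q b nqb qbq IHb a na ra].
    by exists a; apply: unit_lcm.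
  have nq : ~ zeros H q by move=> zq; apply: nqb; apply: zerosMl.
  have [|m qam] := rads (a * q); first by move=> /zeros_mul [].
  have rq := radical_of_radical qbq.
  have lqa := is_lcm_sym (radical_lcm ra rq qam).
  have nm := is_lcm_nonzero nq na lqa.
  have [[u mE] _] := (lqa m).1 (dvdm_refl m); rewrite {}mE in nm lqa qam *.
  have [||m' bum] := IHb u; first by move=> zu; apply: nm; apply: zerosMr.
    apply: (@is_radical_divisor _ q) => //.
    by rewrite mulmC; apply: radical_of_radical qam.
  by exists (q * m'); apply: is_lcm_mul lqa bum.
move=> a b na; move: a na b; apply: (@radical_ind (fun a => forall b,
    ~ zeros H b -> exists m, is_lcm a b m) rads)
  => [a a1 b nb|r a nra rar IHa b nb].
  by exists b; apply: unit_lcm.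
have nr : ~ zeros H r by move=> zr; apply: nra; apply: zerosMl.
have [m lrb'] := radlcm b nb r nr (radical_of_radical rar).
have lrb := is_lcm_sym lrb'; have nm := is_lcm_nonzero nr nb lrb.
have [[u mE] _] := (lrb m).1 (dvdm_refl m); rewrite {}mE in nm lrb *.
have [|m' aum] := IHa u; first by move=> zu; apply: nm; apply: zerosMr.
by exists (r * m'); apply: is_lcm_mul lrb aum.
Qed.

End Radicals.

(** * Products of ideals *)

Section Factorizations.
Variable H : nzCancMonoidType.
Implicit Types (a b c d e p q r x y z : H) (X Y J P : set H).

Lemma mulset_multiples a b :
  mulset (multiples a) (multiples b) = multiples (a * b).
Proof.
rewrite seteqP; split=> [_ [x ax [y bx <-]]|_ [c ->]]; first exact: dvdm_mul.
exists a; first exact: dvdm_refl.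
by exists (b * c); [exact: dvdm_mulr|rewrite mulgA].
Qed.

Lemma mulset1 X : mulset X [set 1] = X.
Proof.
rewrite seteqP; split=> [_ [x Xx [_ -> <-]]|x Xx]; first by rewrite mulg1.
by exists x => //; exists 1 => //; rewrite mulg1.
Qed.

Lemma big_mulset1 (I : 'I_1 -> set H) :
  \big[@mulset H/[set 1]]_(i < 1) I i = I ord0.
Proof. by rewrite big_ord_recl big_ord0 mulset1. Qed.

Definition consf n X (I : 'I_n -> set H) (i : 'I_n.+1) : set H :=
  if unlift ord0 i is Some j then I j else X.

Lemma consfP n X (I : 'I_n -> set H) (Q : set H -> Prop) :
  Q X -> (forall j, Q (I j)) -> forall i, Q (consf X I i).
Proof. by move=> QX QI i; rewrite /consf; case: unliftP. Qed.

Lemma big_consf n X (I : 'I_n -> set H) :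
  \big[@mulset H/[set 1]]_(i < n.+1) consf X I i =
  mulset X (\big[@mulset H/[set 1]]_(i < n) I i).
Proof.
rewrite big_ord_recl /consf unlift_none; congr mulset.
by apply: eq_bigr => i _; rewrite liftK.
Qed.

Lemma big_mulset_sub n (I : 'I_n -> set H) : (forall i, is_ideal (I i)) ->
  forall i, \big[@mulset H/[set 1]]_(i < n) I i `<=` I i.
Proof.
elim: n I => [|n IHn] I iI i; first by case: i.
rewrite big_ord_recl => _ [x Ix [y Iy <-]].
case: (unliftP ord0 i) => [j ->|->]; last exact: (iI _).2.
rewrite mulmC; apply: (iI _).2.
by apply: (IHn (fun i => I (lift ord0 i))) Iy => k; apply: iI.
Qed.

(** An element common to n factors has its n-th power in their product, which
    bounds the intersection of radical factors by the radical of the product. *)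
Lemma big_mulset_exp n (I : 'I_n -> set H) x : (forall i, I i x) ->
  (\big[@mulset H/[set 1]]_(i < n) I i) (x ^+ n).
Proof.
elim: n I => [|n IHn] I Ix; first by rewrite big_ord0.
by rewrite big_ord_recl expgS; exists x => //; exists (x ^+ n) => //; apply: IHn.
Qed.

Lemma big_mulset_directed n (I : 'I_n -> set H) : (forall i, directed (I i)) ->
  directed (\big[@mulset H/[set 1]]_(i < n) I i).
Proof.
move=> dI; apply: (big_ind (@directed H)) => //.
  by move=> _ _ -> ->; exists 1; split=> //; apply: dvd1m.
move=> X Y dX dY _ _ [x Xx [y Yy <-]] [x' Xx' [y' Yy' <-]].
have [d [Xd dx dx']] := dX _ _ Xx Xx'; have [e [Ye ey ey']] := dY _ _ Yy Yy'.
exists (d * e); split; [|exact: dvdm_mul|exact: dvdm_mul].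
by exists d => //; exists e.
Qed.

(** * Chains of radical principal ideals *)

Definition chain_of_radicals P :=
  exists (n : nat) (I : 'I_n.+1 -> set H),
    [/\ forall i, principal_ideal (I i) /\ is_radical (I i),
        forall i j, comparable_sets (I i) (I j)
      & P = \big[@mulset H/[set 1]]_(i < n.+1) I i].

Lemma principal_ideal_ideal P : principal_ideal P -> is_ideal P.
Proof.
move=> /principal_idealP [->|[d _ ->]]; first exact: zeros_ideal.
exact: multiples_ideal.
Qed.

Lemma multiples_principal d : ~ zeros H d -> principal_ideal (multiples d).
Proof. by move=> nd; apply/principal_idealP; right; exists d. Qed.

Lemma chain_of_one P : principal_ideal P -> is_radical P -> chain_of_radicals P.
Proof.
move=> pP rP; exists 0%N, (fun=> P); split=> [//|i j|]; first by left.
by rewrite big_mulset1.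
Qed.

(** The hypothesis on X says that X is contained in every radical ideal above P,
    in particular in each factor of P, so X extends the chain at its bottom. *)
Lemma chain_of_cons X P : principal_ideal X -> is_radical X ->
  (forall Y, is_radical Y -> P `<=` Y -> X `<=` Y) ->
  chain_of_radicals P -> chain_of_radicals (mulset X P).
Proof.
move=> pX rX XP [n [I [prI cI PE]]]; exists n.+1, (consf X I); split.
- by apply: (consfP (Q := fun Y => principal_ideal Y /\ is_radical Y)).
- have XI i : X `<=` I i.
    apply: XP; first by have [] := prI i.
    by rewrite PE; apply: big_mulset_sub => j; apply: principal_ideal_ideal; case: (prI j).
  move=> i j; apply: (consfP (Q := comparable_sets (consf X I i))) => [|k].
    apply: (consfP (Q := fun Y => comparable_sets Y X)) => [|k]; first by left.
    by right.
  by apply: (consfP (Q := fun Y => comparable_sets Y (I k))) => //; left.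
by rewrite big_consf PE.
Qed.

Lemma chains_of_has_radicals : has_radicals H ->
  forall P, principal_ideal P -> chain_of_radicals P.
Proof.
move=> rads P /principal_idealP [->|[a na ->]].
  by apply: chain_of_one; [apply/principal_idealP; left|apply: radical_zeros].
move: a na; apply: (@radical_ind _ (fun a => chain_of_radicals (multiples a)) rads).
  move=> a a1; have aT : multiples a = setT.
    by rewrite seteqP; split=> // x _; apply: dvdm_trans a1 (dvd1m x).
  apply: chain_of_one.
    by apply: multiples_principal; apply: dvdm_nonzero a1 (@zeros1F H).
  by rewrite aT /is_radical seteqP; split=> // x _; exists 1%N.
move=> r b nrb rbr chb; rewrite -mulset_multiples.
apply: chain_of_cons chb.
- by apply: multiples_principal => zr; apply: nrb; apply: zerosMl.
- exact: radical_of_radical rbr.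
move=> Y rY bY; rewrite -rbr; apply: radical_min => // x rbx; apply: bY.
by apply: dvdm_trans rbx; apply: dvdm_mull.
Qed.

Lemma chain_least n (I : 'I_n.+1 -> set H) :
  (forall i j, comparable_sets (I i) (I j)) -> exists k, forall i, I k `<=` I i.
Proof.
elim: n I => [|n IHn] I cI; first by exists ord0 => i; rewrite (ord1 i).
have [|k kI] := IHn (fun i => I (lift ord0 i)); first by move=> i j; apply: cI.
case: (cI ord0 (lift ord0 k)) => [I0k|Ik0].
  exists ord0 => i; case: (unliftP ord0 i) => [j ->|-> //].
  exact: subset_trans (kI j).
by exists (lift ord0 k) => i; case: (unliftP ord0 i) => [j ->|->].
Qed.

(** A power of an element of the least factor lies in the product, since that
    element belongs to all factors. *)
Lemma radical_of_chain P : chain_of_radicals P -> principal_ideal (radical P).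
Proof.
move=> [n [I [prI cI PE]]]; have [k kI] := chain_least cI.
suff -> : radical P = I k by have [] := prI k.
rewrite seteqP; split.
  apply: radical_min; first by have [] := prI k.
  by rewrite PE; apply: big_mulset_sub => j; apply: principal_ideal_ideal; case: (prI j).
move=> x Ix; exists n.+1 => //; rewrite PE; apply: big_mulset_exp => i.
exact: kI.
Qed.

Lemma has_radicalsP : has_radicals H <->
  forall P : set H, principal_ideal P -> principal_ideal (radical P).
Proof.
split=> [rads P|prad a na].
  move=> /principal_idealP [->|[a na ->]].
    by rewrite radical_zeros; apply/principal_idealP; left.
  have [r ar] := rads a na; rewrite ar; apply: multiples_principal.
  by apply: dvdm_nonzero na; have [] := radical_ofP ar.
have /principal_idealP [rz|[r _ rE]] := prad _ (multiples_principal na).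
  by case: na; rewrite -rz; apply/radical_sub/dvdm_refl.
by exists r.
Qed.

(** * Radicals from factorizations of t-ideals *)

(** When the product of the ideals is generated by one of its elements, each
    factor is generated by the corresponding factor of that element, and the
    intersection of the ideals by the lcm of these generators. *)
Lemma factors_lcm n (I : 'I_n -> set H) p : has_lcms H ->
  ~ zeros H p -> (\big[@mulset H/[set 1]]_(i < n) I i) p ->
  \big[@mulset H/[set 1]]_(i < n) I i `<=` multiples p ->
  (forall i, is_ideal (I i)) ->
  exists2 m, ~ zeros H m & forall x, m %| x <-> forall i, I i x.
Proof.
move=> lcms; elim: n I p => [|n IHn] I p np.
  move=> _ _ _; exists 1; first exact: zeros1F.
  by move=> x; split=> [_ []//|_]; apply: dvd1m.
rewrite big_ord_recl => -[q Iq [p' Ip' pE]] Ip iI.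
have nq : ~ zeros H q by move=> zq; apply: np; rewrite -pE; apply: zerosMl.
have np' : ~ zeros H p' by move=> zp; apply: np; rewrite -pE; apply: zerosMr.
have [|m nm mP] := IHn (fun i => I (lift ord0 i)) p' np' Ip' _ (fun i => iI _).
  move=> y Iy; apply: (dvdm_cancel nq); rewrite pE; apply: Ip.
  by exists q => //; exists y.
have I0q x : I ord0 x -> q %| x.
  move=> Ix; apply: (dvdm_cancel np'); rewrite ![p' * _]mulmC pE; apply: Ip.
  by exists x => //; exists p'.
have [l lP] := lcms q m nq nm; exists l; first exact: is_lcm_nonzero nq nm lP.
move=> x; rewrite lP mP; split=> [[qx Ix] i|Ix].
  case: (unliftP ord0 i) => [j ->|->]; first exact: Ix.
  exact: (ideal_dvd (iI _) Iq qx).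
by split; [exact: I0q|move=> i; apply: Ix].
Qed.

(** The ideal aH is the t-closure of the product of the I i, so finitely many
    elements of the product suffice to produce a.  As the product is directed,
    they have a common divisor p in it, and p is associated to a. *)
Lemma has_radicals_of_t_Bezout_SP : r_Bezout_monoid (@t_closure H) ->
  r_SP_monoid (@t_closure H) -> has_radicals H.
Proof.
move=> tB tSP a na; have gcds := gcds_of_t_Bezout tB.
have [n [I [tI aE]]] := tSP _ (t_closure_multiples a).
set PI := \big[_/_]_(i < _) _ in aE.
have PIa : PI `<=` multiples a by rewrite aE; apply: t_closure_sub.
have iI i : is_ideal (I i) by apply: t_ideal_ideal; case: (tI i).
have dPI : directed PI.
  by apply: big_mulset_directed => i; apply: t_ideal_directed; case: (tI i).
have [p PIp pa] : exists2 p, PI p & p %| a.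
  have : multiples a a by apply: dvdm_refl.
  rewrite {1}aE => /t_closureP [//|[s [sPI [e es ne] va]]].
  have [p [PIp pe ps]] := directed_seq dPI (sPI e es) sPI.
  exists p => //; rewrite -(mul1g a); apply: va; first exact: dvdm_nonzero ne.
  by move=> y /ps; rewrite mul1g.
have np : ~ zeros H p by apply: dvdm_nonzero na.
have [|m _ mP] := factors_lcm (lcms_of_gcds gcds) np PIp _ iI.
  by move=> x /PIa; apply: dvdm_trans.
exists m; rewrite /radical_of seteqP; split=> x.
  move=> xa; apply/mP => i; have [_ rI] := tI i.
  move: xa; apply: radical_min => // y ay.
  exact: (ideal_dvd (iI i) (big_mulset_sub iI i PIp) (dvdm_trans pa ay)).
move=> /mP Ix; exists n.+1 => //; apply: PIa.
exact: big_mulset_exp.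
Qed.

(** * Factorizations of t-ideals from radicals *)

(** For a t-ideal J, the ideal generated by the x / rad x with x nonzero in J;
    together with the radical of J it factors J exactly. *)
Definition cofactors J : set H := [set y | exists r b,
  [/\ J (r * b), ~ zeros H (r * b), radical_of (r * b) r & b %| y]].

(** A common divisor g of x and y in J, written as rad g times g / rad g so that
    both factors can be compared with those of x and y. *)
Lemma cofactor_gcd J x y : has_radicals H -> is_ideal J -> directed J ->
  J x -> J y -> ~ zeros H x -> exists r b, [/\ J (r * b), ~ zeros H (r * b),
    radical_of (r * b) r, r * b %| x & r * b %| y].
Proof.
move=> rads iJ dJ Jx Jy nx; have [g [Jg gx gy]] := dJ _ _ Jx Jy.
have ng := dvdm_nonzero gx nx; have [r gr] := rads g ng.
by have [[b gE] _] := radical_ofP gr; rewrite gE in Jg gx gy ng gr; exists r, b.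
Qed.

Lemma cofactors_ideal J e : has_radicals H -> J e -> ~ zeros H e ->
  is_ideal (cofactors J).
Proof.
move=> rads Je ne; split=> [z zz|x y [r [b [Jrb nrb rbr bx]]]].
  have [r er] := rads e ne; have [[b eE] _] := radical_ofP er.
  by rewrite eE in Je ne er; exists r, b; split=> //; apply: dvdm_zero.
by exists r, b; split=> //; apply: dvdm_trans bx (dvdm_mulr _ _).
Qed.

Lemma cofactors_directed J : has_radicals H -> is_ideal J -> directed J ->
  directed (cofactors J).
Proof.
move=> rads iJ dJ x y [r [b [Jrb nrb rbr bx]]] [r' [b' [Jrb' nrb' rbr' bz]]].
have [q [c [Jqc nqc qcq qx qy]]] := cofactor_gcd rads iJ dJ Jrb Jrb' nrb.
exists c; split; first by exists q, c; split=> //; apply: dvdm_refl.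
  by apply: dvdm_trans bx; apply: radical_cofactor_dvd qx.
by apply: dvdm_trans bz; apply: radical_cofactor_dvd qy.
Qed.

Lemma radical_directed J : has_radicals H -> is_ideal J -> directed J ->
  directed (radical J).
Proof.
move=> rads iJ dJ x y [n n0 Jx] [m m0 Jy].
have [zx|nx] := pselect (zeros H x).
  exists y; split; [by exists m|exact: dvdm_zero|exact: dvdm_refl].
have [|q [c [Jqc nqc qcq qx qy]]] := cofactor_gcd rads iJ dJ Jx Jy.
  by move/zeros_exp.
exists q; split.
- have [_ [k qk]] := radical_ofP qcq; exists k.+1 => //.
  exact: (ideal_dvd iJ Jqc qk).
- by change (multiples q x); rewrite -qcq; exists n.
- by change (multiples q y); rewrite -qcq; exists m.
Qed.

(** Every x is rad x times x / rad x.  Conversely, for x with a power in J and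
    y = x' / rad x' with x' in J, take a common divisor g in J of that power
    and x'; then rad g | x, and g / rad g | y by [radical_cofactor_dvd], so that
    g | x y. *)
Lemma radical_mul_cofactors J e : has_radicals H -> is_ideal J -> directed J ->
  J e -> ~ zeros H e -> J = mulset (radical J) (cofactors J).
Proof.
move=> rads iJ dJ Je ne; rewrite seteqP; split=> [x Jx|].
  have [zx|nx] := pselect (zeros H x).
    exists x; first exact: radical_sub.
    by exists x; [apply: (cofactors_ideal rads Je ne).1|rewrite zx].
  have [r [b [Jrb nrb rbr [u xE] _]]] := cofactor_gcd rads iJ dJ Jx Jx nx.
  exists r.
    have [_ [k rk]] := radical_ofP rbr; exists k.+1 => //.
    exact: (ideal_dvd iJ Jrb rk).
  exists (b * u); last by rewrite xE mulgA.
  by exists r, b; split=> //; apply: dvdm_mulr.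
move=> _ [x [n n0 Jx] [y [r [b [Jrb nrb rbr bz]]] <-]].
have [q [c [Jqc nqc qcq qx qy]]] := cofactor_gcd rads iJ dJ Jrb Jx nrb.
apply: (ideal_dvd iJ Jqc); apply: dvdm_mul.
  by change (multiples q x); rewrite -qcq; exists n.
by apply: dvdm_trans bz; apply: radical_cofactor_dvd qx.
Qed.

Definition product_of_radicals (J : set H) :=
  exists (n : nat) (I : 'I_n.+1 -> set H),
    (forall i, r_ideal (@t_closure H) (I i) /\ is_radical (I i)) /\
    J = \big[@mulset H/[set 1]]_(i < n.+1) I i.

Lemma product_of_one J : r_ideal (@t_closure H) J -> is_radical J ->
  product_of_radicals J.
Proof. by move=> tJ rJ; exists 0%N, (fun=> J); rewrite big_mulset1. Qed.

(** The induction runs on a nonzero element a of J: the ideal of cofactors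
    contains the cofactor of a, which is the next element in [radical_ind]. *)
Lemma products_of_has_radicals J : has_radicals H ->
  r_ideal (@t_closure H) J -> product_of_radicals J.
Proof.
move=> rads tJ; have gcds := gcds_of_lcms (lcms_of_radicals rads).
have [[a Ja na]|Jz] := pselect (exists2 a, J a & ~ zeros H a); last first.
  have JE : J = zeros H.
    rewrite seteqP; split=> [x Jx|]; last exact: (t_ideal_ideal tJ).1.
    by apply: contrapT => nx; apply: Jz; exists x.
  by apply: product_of_one => //; rewrite JE; apply: radical_zeros.
move: a na J tJ Ja; apply: (@radical_ind _ (fun a => forall J,
    r_ideal (@t_closure H) J -> J a -> product_of_radicals J) rads).
  move=> a a1 J tJ Ja; apply: product_of_one => //.
  rewrite /is_radical seteqP; split=> [x _|]; last exact: radical_sub.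
  by apply: (ideal_dvd (t_ideal_ideal tJ) Ja); apply: dvdm_trans a1 (dvd1m x).
move=> r b nrb rbr IHb J tJ Jrb.
have iJ := t_ideal_ideal tJ; have dJ := t_ideal_directed gcds tJ.
have [||n [I [tI JE]]] := IHb (cofactors J).
- apply: directed_t_ideal; first exact: cofactors_ideal Jrb nrb.
  exact: cofactors_directed.
- by exists r, b; split=> //; apply: dvdm_refl.
exists n.+1, (consf (radical J) I); split.
  apply: (consfP (Q := fun X => r_ideal (@t_closure H) X /\ is_radical X)) => //.
  split; last exact: radical_idem.
  by apply: directed_t_ideal; [exact: radical_ideal|exact: radical_directed].
by rewrite big_consf -JE -(radical_mul_cofactors rads iJ dJ Jrb nrb).
Qed.

Lemma t_SP_of_has_radicals : has_radicals H -> r_SP_monoid (@t_closure H).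
Proof.
move=> rads J tJ; have [n [I [tI JE]]] := products_of_has_radicals rads tJ.
by exists n, I; split=> //; rewrite -JE tJ.
Qed.

End Factorizations.

(** * The equivalence *)

Theorem corollary4p5 (H : nzCancMonoidType) :
  [<-> r_Bezout_monoid (@t_closure H) /\ r_SP_monoid (@t_closure H);
       r_Bezout_monoid (@w_closure H) /\ r_SP_monoid (@w_closure H);
       forall P : set H, principal_ideal P -> principal_ideal (radical P);
       forall P : set H, principal_ideal P ->
         exists (n : nat) (I : 'I_n.+1 -> set H),
           [/\ forall i, principal_ideal (I i) /\ is_radical (I i),
               forall i j, comparable_sets (I i) (I j)
             & P = \big[@mulset H/[set 1]]_(i < n.+1) I i]].
Proof.
tfae.
- by move=> [tB tSP]; rewrite (w_eq_t_of_t_Bezout tB).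
- move=> [wB wSP]; have wt := w_eq_t_of_w_Bezout wB.
  rewrite wt in wB wSP.
  exact/has_radicalsP/has_radicals_of_t_Bezout_SP.
- by move=> /has_radicalsP; apply: chains_of_has_radicals.
move=> chains; have rads : has_radicals H.
  by apply/has_radicalsP => P /chains; apply: radical_of_chain.
split; last exact: t_SP_of_has_radicals.
exact/t_Bezout_of_gcds/gcds_of_lcms/lcms_of_radicals.
Qed.
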